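(* For all $n\ge 3$, $$\Big\lfloor\frac{n^2}{4}\Big\rfloor-1\le \mathrm{ex}_\circlearrowright(n,S_2)\le\frac{23}{64}n^2.$$
   Context: $\Omega_n=\{v_0,\dots,v_{n-1}\}$ is the vertex set of a regular $n$-gon with the clockwise cyclic ordering. We write $x_1<x_2<\dots<x_k<x_1$ to mean that $x_1,\dots,x_k$ are distinct and occur in this clockwise cyclic order. A convex geometric hypergraph (cgh) on $\Omega_n$ is a set $H$ of $3$-element subsets (edges) of $\Omega_n$. A cgh $H$ contains a cgh $F$ if there is an injection from the vertex set of $F$ to the vertex set of $H$ preserving the cyclic ordering and mapping edges to edges; otherwise $H$ is $F$-free. $\mathrm{ex}_\circlearrowright(n,F)$ is the maximum number of edges in an $F$-free cgh on $\Omega_n$. $S_2$ is the cgh with two edges $\{x_1,x_2,x_5\},\{x_1,x_3,x_4\}$, where $x_1<x_2<x_3<x_4<x_5<x_1$. *)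

(* Defs.v *)
From mathcomp Require Import all_boot all_order all_algebra.

Set Implicit Arguments.
Unset Strict Implicit.
Unset Printing Implicit Defensive.

(* The vertex v_i of the regular n-gon is encoded by i : 'I_n, the vertices
   being numbered clockwise.  [cyclic_lt x y z] is x < y < z < x; it forces
   x, y and z to be distinct. *)
Definition cyclic_lt (n : nat) (x y z : 'I_n) : bool :=
  [|| (x < y) && (y < z), (y < z) && (z < x) | (z < x) && (x < y)].

Definition is_cgh (n : nat) (H : {set {set 'I_n}}) : bool :=
  [forall e in H, #|e| == 3].

Definition preserves_cyclic_order (m n : nat) (f : 'I_m -> 'I_n) : bool :=
  [forall x, forall y, forall z,
     cyclic_lt x y z ==> cyclic_lt (f x) (f y) (f z)].

Definition contains (m n : nat) (H : {set {set 'I_n}}) (F : {set {set 'I_m}}) :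
    bool :=
  [exists f : {ffun 'I_m -> 'I_n},
     [&& injectiveb f, preserves_cyclic_order f
       & [forall e in F, f @: e \in H]]].

(* The maximum of an empty family is 0, which is harmless: the empty cgh is
   F-free as soon as F has an edge. *)
Definition ex_cyc (n m : nat) (F : {set {set 'I_m}}) : nat :=
  \max_(H : {set {set 'I_n}} | is_cgh H && ~~ contains H F) #|H|.

(* x_1 < x_2 < x_3 < x_4 < x_5 < x_1 are the vertices 0, 1, 2, 3, 4 of the
   pentagon. *)
Definition S2 : {set {set 'I_5}} :=
  let x1 : 'I_5 := @Ordinal 5 0 isT in
  let x2 : 'I_5 := @Ordinal 5 1 isT in
  let x3 : 'I_5 := @Ordinal 5 2 isT in
  let x4 : 'I_5 := @Ordinal 5 3 isT in
  let x5 : 'I_5 := @Ordinal 5 4 isT in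
  [set [set x1; x2; x5]; [set x1; x3; x4]].

(* Main.v *)
(** Call the directed pair (v, a) used if some edge {v, a, b} has v < a < b < v.
    Two facts about an S_2-free cgh drive the upper bound.

    - If v < a < b < v and (v, a), (a, b), (b, v) are all used, then {v, a, b}
      is an edge.  Otherwise, take third vertices p, q, s of edges on these
      pairs.  Each lies strictly before or strictly after the remaining vertex
      of the triangle, and two consecutive choices on the same side give an S_2.
    - Call an edge {v, a, b} last on (v, a) if no edge {v, a, c} has
      v < b < c < v.  An edge is last on at least two of its three sides, since
      two ways of moving a vertex clockwise would give an S_2.

    Count the pairs of a used (v, a) and a vertex c with v < a < c < v.  By the
    first fact there are at most 2 C(n, 3) + |H|.  Every used pair has at most
    one last edge, and two sides of a triangle have together at least n - 1
    vertices on their far sides, so the second fact gives at least (n - 1) |H|.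
    Hence |H| <= n (n - 1) / 3, which is below 23 n^2 / 64. *)
Require Import Defs.
From mathcomp Require Import all_boot all_order all_algebra.
From mathcomp Require Import zify lra.

Set Implicit Arguments.
Unset Strict Implicit.
Unset Printing Implicit Defensive.

Import Order.TTheory GRing.Theory Num.Theory.
Local Open Scope ring_scope.

(** * Triples in cyclic order *)

Section CyclicOrder.
Local Open Scope nat_scope.
Variable n : nat.
Implicit Types v a b c : 'I_n.

Lemma cyclic_lt_rot v a b : cyclic_lt v a b = cyclic_lt a b v.
Proof. rewrite /cyclic_lt; lia. Qed.

Lemma cyclic_lt_neq v a b :
  cyclic_lt v a b -> [/\ v != a, a != b & b != v].
Proof. by rewrite /cyclic_lt -!val_eqE /= => ?; split; lia. Qed.

Lemma cyclic_lt_total v a b : v != a -> a != b -> b != v ->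
  cyclic_lt v a b + cyclic_lt v b a = 1.
Proof. by rewrite /cyclic_lt -!val_eqE /=; lia. Qed.

Lemma cyclic_lt_cover v a b c : cyclic_lt v a b -> c != a ->
  cyclic_lt v a c || cyclic_lt a b c.
Proof. by rewrite /cyclic_lt -!val_eqE /=; lia. Qed.

(* The number of vertices on the open arc from a clockwise to v. *)
Definition arc_compl v a := \sum_b cyclic_lt v a b.

(** The open arcs from [a] to [v] and from [b] to [a] together cover every vertex except [a]. *)
Lemma arc_compl_add v a b : cyclic_lt v a b ->
  n.-1 <= arc_compl v a + arc_compl a b.
Proof.
move=> vab; rewrite -big_split /= -[n in n.-1](card_ord n) -(cardC1 a).
rewrite -sum1_card big_mkcond; apply: leq_sum => c _ /=.
rewrite inE; case: eqP => //= /eqP /(cyclic_lt_cover vab).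
by case: cyclic_lt => //=; case: cyclic_lt.
Qed.

(** Each 3-set is counted once per starting vertex, so this is 3 C(n, 3). *)
Definition cyclic_triples := \sum_(v < n) \sum_a \sum_b cyclic_lt v a b.

Lemma cyclic_triplesE : cyclic_triples.*2 = n * n.-1 * n.-2.
Proof.
have -> : cyclic_triples.*2 =
    \sum_(v < n) \sum_a \sum_b (cyclic_lt v a b + cyclic_lt v b a).
  rewrite -addnn -big_split; apply: eq_bigr => v _ /=.
  under [RHS]eq_bigr do rewrite big_split.
  by rewrite big_split /= [X in _ + X = _]exchange_big.
have Ev v : \sum_a \sum_b (cyclic_lt v a b + cyclic_lt v b a) = n.-1 * n.-2.
  rewrite (bigID (pred1 v)) /= big_pred1_eq big1 ?add0n; last first.
    by move=> b _; rewrite /cyclic_lt; lia.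
  rewrite (eq_bigr (fun=> n.-2)) => [|a neq_av].
    by rewrite sum_nat_const cardC1 card_ord.
  rewrite -[n in RHS](card_ord n) -(cardC1 v) (cardD1 a) inE neq_av /=.
  rewrite -sum1_card [RHS]big_mkcond; apply: eq_bigr => b _.
  rewrite !inE; case: eqP => [-> |/eqP nba] /=.
    by rewrite /cyclic_lt; lia.
  case: eqP => [-> |/eqP nbv] /=; first by rewrite /cyclic_lt; lia.
  by rewrite cyclic_lt_total // 1?[v == a]eq_sym 1?[a == b]eq_sym.
by rewrite (eq_bigr _ (fun v _ => Ev v)) sum_nat_const card_ord mulnA.
Qed.

Lemma sum3_rot (F : 'I_n -> 'I_n -> 'I_n -> nat) :
  \sum_v \sum_a \sum_b F a b v = \sum_v \sum_a \sum_b F v a b.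
Proof.
rewrite exchange_big; apply: eq_bigr => a _.
by rewrite exchange_big.
Qed.

(** Reduces an inequality between such sums to one triangle at a time, with its three sides taken
    together. *)
Lemma sum3_cyclic (F : 'I_n -> 'I_n -> 'I_n -> nat) :
  3 * \sum_v \sum_a \sum_b F v a b
  = \sum_v \sum_a \sum_b (F v a b + F a b v + F b v a).
Proof.
under [RHS]eq_bigr => v _.
  under eq_bigr do rewrite !big_split.
  rewrite !big_split; over.
rewrite !big_split /= (sum3_rot (fun v a b => F a b v)) (sum3_rot F).
by rewrite !mulSn addn0 addnA.
Qed.

End CyclicOrder.

(** * The upper bound *)

Section UpperBound.
Local Open Scope nat_scope.
Variables (n : nat) (H : {set {set 'I_n}}).
Hypothesis cghH : is_cgh H.
Hypothesis freeH : ~~ contains H S2.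
Implicit Types v a b c : 'I_n.

Definition tri v a b := [set v; a; b] \in H.

Lemma tri_rot v a b : tri v a b = tri a b v.
Proof. by rewrite /tri -setUA setUC. Qed.

Lemma S2_free_nested (x1 x2 x3 x4 x5 : 'I_n) :
  cyclic_lt x1 x2 x3 -> cyclic_lt x1 x3 x4 -> cyclic_lt x1 x4 x5 ->
  tri x1 x2 x5 -> ~~ tri x1 x3 x4.
Proof.
move=> c1 c2 c3 t1; apply: contra freeH => t2.
pose s := [:: x1; x2; x3; x4; x5].
pose f := [ffun i : 'I_5 => nth x1 s i].
apply/existsP; exists f; apply/and3P; split.
- apply/injectiveP => i j; rewrite !ffunE; move: c1 c2 c3; rewrite /cyclic_lt.
  case: i => -[|[|[|[|[|//]]]]] ? /=; case: j => -[|[|[|[|[|//]]]]] ? /=;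
    move=> ? ? ? eqx; apply: val_inj => //=; exfalso;
    move: (congr1 val eqx) => /=; lia.
- apply/forallP => i; apply/forallP => j; apply/forallP => k.
  rewrite !ffunE; move: c1 c2 c3; rewrite /cyclic_lt.
  case: i => -[|[|[|[|[|//]]]]] ? /=; case: j => -[|[|[|[|[|//]]]]] ? //=;
    case: k => -[|[|[|[|[|//]]]]] ? //=; lia.
apply/forallP => e; apply/implyP; rewrite !inE => /orP [] /eqP ->;
  by rewrite !imsetU !imset_set1 !ffunE.
Qed.

Definition used v a := [exists b, cyclic_lt v a b && tri v a b].

Lemma tri_used v a b : cyclic_lt v a b -> tri v a b -> used v a.
Proof. by move=> vab t; apply/existsP; exists b; rewrite vab. Qed.

(* [cyclic_lt v b p] says that p lies beyond b, seen from (v, a), and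
   [cyclic_lt a v q] that q lies beyond v, seen from (a, b).  Going around the
   triangle, this alternation is applied three times: an odd number. *)
Lemma third_alternate v a b p q : cyclic_lt v a b -> ~~ tri v a b ->
  cyclic_lt v a p -> tri v a p -> cyclic_lt a b q -> tri a b q ->
  cyclic_lt v b p = ~~ cyclic_lt a v q.
Proof.
move=> vab nt vap tp abq tq.
have neq_pb : p != b by apply: contra nt => /eqP <-.
have neq_qv : q != v by apply: contra nt => /eqP <-; rewrite tri_rot.
have tp' : tri a p v by rewrite -tri_rot.
case: (boolP (cyclic_lt v b p)) => P; case: (boolP (cyclic_lt a v q)) => Q //.
  (* Both beyond: a < b < p < v < q < a, and {a, b, q}, {a, p, v} form an S_2. *)
  have: ~~ tri a p v; last by rewrite tp'.
  by apply: (S2_free_nested _ _ _ tq);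
    move: vab vap abq P Q; rewrite /cyclic_lt; lia.
(* Neither beyond: a < p < b < q < v < a, and {a, p, v}, {a, b, q} form an S_2. *)
have: ~~ tri a b q; last by rewrite tq.
by apply: (S2_free_nested _ _ _ tp'); move: vab vap abq P Q neq_pb neq_qv;
  rewrite /cyclic_lt -!val_eqE /=; lia.
Qed.

Lemma used_cyclic_tri v a b : cyclic_lt v a b ->
  used v a -> used a b -> used b v -> tri v a b.
Proof.
move=> vab /existsP[p /andP[vap tp]] /existsP[q /andP[abq tq]].
move=> /existsP[s /andP[bvs ts]]; apply/negPn/negP => nt.
have abv : cyclic_lt a b v by rewrite -cyclic_lt_rot.
have bva : cyclic_lt b v a by rewrite -cyclic_lt_rot.
have := third_alternate vab nt vap tp abq tq.
have nt' : ~~ tri a b v by rewrite -tri_rot.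
rewrite (third_alternate abv nt' abq tq bvs ts).
rewrite tri_rot in nt'; rewrite (third_alternate bva nt' bvs ts vap tp).
by case: cyclic_lt.
Qed.

Definition last_tri v a b :=
  [&& cyclic_lt v a b, tri v a b
    & [forall c, cyclic_lt v b c ==> ~~ tri v a c]].

Lemma last_tri_used v a : \sum_b last_tri v a b <= used v a.
Proof.
case: (pickP (last_tri v a)) => [b lb|nl]; last first.
  by rewrite big1 // => b _; rewrite nl.
have /and3P[vab tb /forallP mb] := lb.
rewrite (tri_used vab tb) (bigD1 b) //= lb big1 // => c neq_cb.
apply/eqP; rewrite eqb0; apply/negP => /and3P[vac tc /forallP mc].
move: (mb c) (mc b); rewrite tb tc !implybF => n1 n2.
have [nva nab nbv] := cyclic_lt_neq vab.
have [_ _ ncv] := cyclic_lt_neq vac.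
have := @cyclic_lt_total _ v b c; rewrite (negPf n1) (negPf n2).
by rewrite eq_sym nbv eq_sym neq_cb ncv => /(_ isT isT isT).
Qed.

(** If both fail, [b] moves on to some [b'] and [v] to some [v'], so a < b < b' < v < v' < a and {a,
    b, v'}, {a, b', v} form an S_2. Over the three rotations this leaves at most one side that is
    not last. *)
Lemma last_tri_two v a b : cyclic_lt v a b -> tri v a b ->
  last_tri v a b || last_tri a b v.
Proof.
move=> vab t; apply/orP; case: (boolP (last_tri v a b)) => [|nl1]; first by left.
right; move: nl1; rewrite /last_tri -(tri_rot v a b) -(cyclic_lt_rot v a b) vab t /= negb_forall.
move=> /existsP[b']; rewrite negb_imply negbK => /andP[vbb' tb'].
apply/forallP => v'; apply/implyP => avv'; apply/negP => tv'.
have: ~~ tri a b' v.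
  apply: (@S2_free_nested a b b' v v') => //;
    move: vab vbb' avv'; rewrite /cyclic_lt; lia.
by rewrite -tri_rot tb'.
Qed.

Definition cyclic_tris :=
  \sum_v \sum_a \sum_b (cyclic_lt v a b && tri v a b : nat).

Lemma cyclic_tris_le : n.-2 * cyclic_tris <= cyclic_triples n * 2.
Proof.
(* The final subtraction needs [n.-1 = n.-2 + 1], which fails under truncation for n < 2. *)
have [n_lt2|n_ge2] := ltnP n 2; first by rewrite (_ : n.-2 = 0) //; lia.
pose S := \sum_v \sum_a \sum_b (cyclic_lt v a b && used v a : nat).
(* A triangle has at most two used sides, or three if it is an edge. *)
have S_le : 3 * S <= cyclic_triples n * 2 + cyclic_tris.
  rewrite (sum3_cyclic (fun v a b => cyclic_lt v a b && used v a)).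
  rewrite /cyclic_triples big_distrl -big_split; apply: leq_sum => v _ /=.
  rewrite big_distrl -big_split; apply: leq_sum => a _ /=.
  rewrite big_distrl -big_split; apply: leq_sum => b _ /=.
  rewrite -(cyclic_lt_rot v) (cyclic_lt_rot b).
  case: (boolP (cyclic_lt v a b)) => //= vab.
  have := @used_cyclic_tri v a b vab.
  case: (used v a) (used a b) (used b v) (tri v a b) => -[] [] [] //=.
  by move/(_ isT isT isT).
have S_ge : n.-1 * cyclic_tris <= 3 * S.
  (* A used pair contributes its whole far arc to [S], and it has at most one last edge to charge it
     to. *)
  have S_last : \sum_v \sum_a \sum_b last_tri v a b * arc_compl v a <= S.
    apply: leq_sum => v _; apply: leq_sum => a _; rewrite -big_distrl /=.
    apply: leq_trans (leq_mul (last_tri_used v a) (leqnn _)) _.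
    rewrite big_distrr /=; apply: leq_sum => b _.
    by case: (used v a); rewrite ?mul0n // mul1n andbT.
  apply: leq_trans (leq_mul (leqnn 3) S_last).
  rewrite (sum3_cyclic (fun v a b => last_tri v a b * arc_compl v a)).
  rewrite big_distrr; apply: leq_sum => v _ /=.
  rewrite big_distrr; apply: leq_sum => a _ /=.
  rewrite big_distrr; apply: leq_sum => b _ /=.
  case: (boolP (cyclic_lt v a b)) => //= vab; last by rewrite muln0.
  case: (boolP (tri v a b)) => t; last by rewrite muln0.
  have abv : cyclic_lt a b v by rewrite -cyclic_lt_rot.
  have bva : cyclic_lt b v a by rewrite -cyclic_lt_rot.
  have tabv : tri a b v by rewrite -tri_rot.
  have tbva : tri b v a by rewrite -tri_rot.
  have := last_tri_two vab t; have := last_tri_two abv tabv.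
  have := last_tri_two bva tbva.
  have := arc_compl_add vab; have := arc_compl_add abv.
  have := arc_compl_add bva.
  case: (last_tri v a b) (last_tri a b v) (last_tri b v a) => -[] [] //=; lia.
nia.
Qed.

(** The clockwise listing of an edge has three distinct rotations, all counted by [cyclic_tris]. *)
Lemma card_cyclic_tris : 3 * #|H| <= cyclic_tris.
Proof.
pose C := [set t : 'I_n * ('I_n * 'I_n) |
  cyclic_lt t.1 t.2.1 t.2.2 && tri t.1 t.2.1 t.2.2].
pose g (t : 'I_n * ('I_n * 'I_n)) := [set t.1; t.2.1; t.2.2].
have -> : cyclic_tris = #|C|.
  rewrite /cyclic_tris (eq_bigr _ (fun v _ => pair_bigA _ _)) /= pair_bigA /=.
  rewrite -sum1_card [RHS]big_mkcond; apply: eq_bigr => t _.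
  by rewrite inE; case: ifP.
have -> : #|C| = \sum_(e in H) #|[set t in C | g t == e]|.
  rewrite -sum1_card (partition_big g (mem H)) /=.
    apply: eq_bigr => e _; rewrite -sum1_card; apply: eq_bigl => t.
    by rewrite inE.
  by move=> t; rewrite inE => /andP[].
rewrite mulnC -sum_nat_const; apply: leq_sum => e eH.
have: #|e| == 3 by move/forallP: cghH => /(_ e); rewrite eH.
move=> card_e.
have [x [y [z [xyz e_def]]]] : exists x y z, cyclic_lt x y z /\ e = [set x; y; z].
  have /card_gt0P[x xe] : 0 < #|e| by rewrite (eqP card_e).
  move: card_e; rewrite (cardsD1 x) xe eqSS => /cards2P[y [z [nyz yz_def]]].
  have: x \notin e :\ x by rewrite !inE eqxx.
  rewrite yz_def !inE negb_or => /andP[nxy nxz].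
  have := cyclic_lt_total nxy nyz; rewrite eq_sym => /(_ nxz).
  have e_def : e = [set x; y; z] by rewrite -setUA -yz_def setD1K.
  case: (boolP (cyclic_lt x y z)) => [xyz _|_ xzy]; first by exists x, y, z.
  exists x, z, y; split; first by case: cyclic_lt xzy.
  by rewrite e_def -!setUA [[set y] :|: _]setUC.
have [nxy nyz nzx] := cyclic_lt_neq xyz.
pose s := [:: (x, (y, z)); (y, (z, x)); (z, (x, y))].
have <- : #|s| = 3.
  apply/card_uniqP; rewrite /= !inE !xpair_eqE (negPf nxy) (negPf nyz) /=.
  by rewrite eq_sym (negPf nzx).
have yzx : cyclic_lt y z x by rewrite -cyclic_lt_rot.
have zxy : cyclic_lt z x y by rewrite -cyclic_lt_rot.
have t : tri x y z by rewrite /tri -e_def.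
apply/subset_leq_card/subsetP => u; rewrite !inE => /or3P[] /eqP-> /=.
- by rewrite xyz t e_def /g eqxx.
- by rewrite yzx -tri_rot t e_def /g /= setUC setUA eqxx.
- by rewrite zxy tri_rot t e_def /g /= -setUA setUC eqxx.
Qed.

Lemma card_S2_free : 2 < n -> 3 * #|H| <= n * n.-1.
Proof.
move=> n_gt2; have := cyclic_tris_le; have := card_cyclic_tris.
by have := cyclic_triplesE n; nia.
Qed.

End UpperBound.

(** * The lower bound *)

Section LowerBound.
Local Open Scope nat_scope.

(* The edges are the triples {i, j, j+1} with p <= j and i < p, together with
   the runs of three consecutive vertices among p, ..., n-1 (and
   {p-1, p, p+1}, which is already of the first kind). *)
Definition sorted_edge (p i j k : nat) : bool :=
  [&& i < j, k == j.+1, p <= j & (i < p) || (j == i.+1)].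

Definition sorted_cgh (n p : nat) : {set {set 'I_n}} :=
  [set [set t.1; t.2.1; t.2.2] | t : 'I_n * ('I_n * 'I_n)
     & sorted_edge p t.1 t.2.1 t.2.2].

Lemma sorted_cgh_edge n p (x y z : 'I_n) : cyclic_lt x y z ->
  [set x; y; z] \in sorted_cgh n p ->
  [|| sorted_edge p x y z, sorted_edge p y z x | sorted_edge p z x y].
Proof.
move=> xyz /imsetP[[i [j k]]]; rewrite inE /= => e_ijk eq_e.
have: (x \in [set i; j; k]) && (y \in [set i; j; k]) && (z \in [set i; j; k]).
  by rewrite -eq_e !inE !eqxx !orbT.
move: xyz e_ijk; rewrite !inE -!val_eqE /= /cyclic_lt /sorted_edge.
by lia.
Qed.

Lemma sorted_cgh_is_cgh n p : is_cgh (sorted_cgh n p).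
Proof.
apply/forall_inP => e /imsetP[[i [j k]]]; rewrite inE /= => e_ijk ->.
rewrite setUC cardsU1 cards2 !inE -!val_eqE /=.
by move: e_ijk; rewrite /sorted_edge; lia.
Qed.

(** Every edge has a pair j, j+1 with p <= j as its two largest vertices. In {x1, x2, x5} this pair
    contains x1, as x2 and x5 are separated on both sides; hence x1 >= p. In {x1, x3, x4} it can
    only be x3, x4, so x1 is least and x3 = x1 + 1, leaving no room for x2. *)
Lemma sorted_cgh_S2_free n p : ~~ contains (sorted_cgh n p) S2.
Proof.
apply/negP => /existsP[f /and3P[_ /forallP cyc_f /forall_inP tri_f]].
have cyc i j k : cyclic_lt i j k -> cyclic_lt (f i) (f j) (f k).
  by move: (cyc_f i) => /forallP/(_ j)/forallP/(_ k)/implyP.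
pose x1 : 'I_5 := @Ordinal 5 0 isT; pose x2 : 'I_5 := @Ordinal 5 1 isT.
pose x3 : 'I_5 := @Ordinal 5 2 isT; pose x4 : 'I_5 := @Ordinal 5 3 isT.
pose x5 : 'I_5 := @Ordinal 5 4 isT.
have t1 : [set f x1; f x2; f x5] \in sorted_cgh n p.
  rewrite -!imset_set1 -!imsetU; apply: tri_f.
  by rewrite !inE eqxx.
have t2 : [set f x1; f x3; f x4] \in sorted_cgh n p.
  rewrite -!imset_set1 -!imsetU; apply: tri_f.
  by rewrite !inE eqxx orbT.
have c125 : cyclic_lt (f x1) (f x2) (f x5) by apply: cyc.
have c134 : cyclic_lt (f x1) (f x3) (f x4) by apply: cyc.
have c123 : cyclic_lt (f x1) (f x2) (f x3) by apply: cyc.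
have c145 : cyclic_lt (f x1) (f x4) (f x5) by apply: cyc.
have := sorted_cgh_edge c134 t2; have := sorted_cgh_edge c125 t1.
move: c123 c145 c125 c134 {t1 t2}.
move: (f x1) (f x2) (f x3) (f x4) (f x5) => y1 y2 y3 y4 y5.
by rewrite /sorted_edge /cyclic_lt; lia.
Qed.

Lemma card_sorted_cgh n p q : n = p + q.+1 -> 0 < q ->
  p.+1 * q - 1 <= #|sorted_cgh n p|.
Proof.
case: n => [|n] n_def q_gt0; first by lia.
rewrite card_in_imset; last first.
  move=> [i [j k]] [i' [j' k']]; rewrite !inE /= => t t' eq_e.
  have mem (u : 'I_n.+1) :
      (u \in [set i; j; k]) = (u \in [set i'; j'; k']) by rewrite eq_e.
  have := mem i; have := mem j; have := mem k.
  have := mem i'; have := mem j'; have := mem k'.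
  rewrite !inE !eqxx !orbT -!val_eqE /= => ? ? ? ? ? ?.
  move: t t'; rewrite /sorted_edge => t t'.
  by congr (_, (_, _)); apply: val_inj => /=; lia.
(* There are p q edges with i < p, and q - 1 runs starting at p or later. *)
pose h (u : ('I_p * 'I_q) + 'I_q.-1) : 'I_n.+1 * ('I_n.+1 * 'I_n.+1) :=
  match u with
  | inl (i, j) => (inord i, (inord (p + j), inord (p + j).+1))
  | inr i => (inord (p + i), (inord (p + i).+1, inord (p + i).+2))
  end.
have inordE m : m <= n -> (inord m : 'I_n.+1) = m :> nat by exact: inordK.
have h_inj : injective h.
  move=> [[i j]|i] [[i' j']|i'] /= [] e1 e2 _;
    move: (congr1 val e1) (congr1 val e2) => {e1 e2} /=;
    have := ltn_ord i; have := ltn_ord i'.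
  - have := ltn_ord j; have := ltn_ord j' => ? ? ? ?; rewrite !inordE; try lia.
    by move=> ? ?; congr (inl (_, _)); apply: val_inj => /=; lia.
  - by have := ltn_ord j => ? ? ?; rewrite !inordE; lia.
  - by have := ltn_ord j' => ? ? ?; rewrite !inordE; lia.
  - move=> ? ?; rewrite !inordE; try lia.
    by move=> ? ?; congr inr; apply: val_inj => /=; lia.
have -> : p.+1 * q - 1 = #|{: ('I_p * 'I_q) + 'I_q.-1}|.
  by rewrite card_sum card_prod !card_ord; nia.
rewrite -(card_imset _ h_inj); apply/subset_leq_card/subsetP => t.
case/imsetP => -[[i j]|i] _ ->; rewrite inE /sorted_edge /=.
- by have := ltn_ord i; have := ltn_ord j => ? ?; rewrite !inordE; lia.
- by have := ltn_ord i => ?; rewrite !inordE; lia.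
Qed.

End LowerBound.

Theorem theorem5 (n : nat) (hn : (3 <= n)%N) :
  (n ^ 2 %/ 4 - 1 <= ex_cyc n S2)%N /\
  ((ex_cyc n S2)%:R : rat) <= 23%:R / 64%:R * n%:R ^+ 2.
Proof.
split.
  (* Then p + 1 and q are n/2 rounded down and up, with product equal to the floor of n^2/4. *)
  pose p := (n./2.-1)%N; pose q := (n - p.+1)%N.
  have n_def : (n = p + q.+1)%N by rewrite /q /p; lia.
  have q_gt0 : (0 < q)%N by rewrite /q /p; lia.
  have le_pq : (n ^ 2 %/ 4 <= p.+1 * q)%N.
    rewrite /q /p; set m := n./2; have [n_def'|n_def'] : n = m.*2 \/ n = m.*2.+1
      by rewrite /m; lia.
    - rewrite n_def'; have -> : (m.*2 ^ 2 = m * m * 4)%N by nia.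
      by rewrite mulnK //; nia.
    - have -> : (n ^ 2 = m * m.+1 * 4 + 1)%N by rewrite n_def'; nia.
      by rewrite divnMDl // addn0 n_def'; nia.
  apply: leq_trans (leq_sub2r 1 le_pq) _.
  apply: leq_trans (card_sorted_cgh n_def q_gt0) _.
  apply: (@leq_bigmax_cond _ _ (fun H : {set {set 'I_n}} => #|H|)).
  by rewrite sorted_cgh_is_cgh sorted_cgh_S2_free.
have ex_le : (3 * ex_cyc n S2 <= n * n.-1)%N.
  rewrite /ex_cyc; apply: (big_ind (fun m => 3 * m <= n * n.-1)%N) => //.
  - by move=> x y; rewrite maxnMr geq_max => -> ->.
  - by move=> H /andP[cghH freeH] /=; exact: card_S2_free.
(* There is slack here: 64/3 < 23. *)
have : (64 * ex_cyc n S2 <= 23 * n ^ 2)%N by nia.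
by rewrite -(ler_nat rat) !natrM expr2; lra.
Qed.
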